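(* Let $p$ be an odd prime, $n\ge 1$, and let $f(x)=\sum_{i=1}^k a_i x^{p^{\alpha_i}+1}\in\mathbb F_{p^n}[x]$ with $k\ge 1$, integers $0\le\alpha_1<\cdots<\alpha_k$, and $a_k\ne 0$. Assume $\nu_p(n)<\min\{\nu_p(\alpha_i):1\le i\le k\}$. Then $$S(f,pn)=p^{\frac12(p-3)(n+l_n(f))}\,|S(f,n)|^2\,\overline{S(f,n)}.$$ Moreover, $$l_{pn}(f)=p\,l_n(f)\qquad\text{and}\qquad t_{pn}(f)=t_n(f).$$
   Context: $\nu_p$ is the $p$-adic order, with $\nu_p(0)=\infty$. For a positive integer $N$ divisible by $n$, $\mathrm{Tr}_N$ is the absolute trace $\mathbb F_{p^N}\to\mathbb F_p$, $e_N(y)=e^{2\pi i\,\mathrm{Tr}_N(y)/p}$ for $y\in\mathbb F_{p^N}$, and $S(f,N)=\sum_{x\in\mathbb F_{p^N}}e_N(f(x))$. Every quadratic form $F$ on an $N$-dimensional $\mathbb F_p$-vector space ($p$ odd) is, after a linear change of coordinates, equal to $x_1^2+\cdots+x_{r-1}^2+d x_r^2$ with $r\ge 0$ and $d\in\mathbb F_p^*$. The integer $r$ is the rank of $F$, $N-r$ is its nullity, and $\eta(d)\in\{\pm1\}$ is its type, where $\eta$ is the quadratic character of $\mathbb F_p$; if $F=0$ its type is defined to be $1$. The map $x\mapsto \mathrm{Tr}_N(f(x))$ is a quadratic form on the $N$-dimensional $\mathbb F_p$-space $\mathbb F_{p^N}$, and $l_N(f)$, $t_N(f)$ denote its nullity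 and type. *)

(* Defs.v *)
From HB Require Import structures.
From mathcomp Require Export all_boot all_order all_algebra all_field.
From mathcomp Require Export complex.
From mathcomp Require Export all_classical all_reals all_analysis.

Set Implicit Arguments.
Unset Strict Implicit.
Unset Printing Implicit Defensive.

Import Order.TTheory GRing.Theory Num.Theory.
Local Open Scope ring_scope.

(* The p-adic order of a natural number, with value +oo at 0. *)
Definition padic_order (p m : nat) : \bar int :=
  if m == 0 then +oo%E else ((logn p m)%:Z%:E)%E.

Section TraceAndExponentialSum.
Variables (p : nat) (L : fieldExtType 'F_p).

(* The field with p ^ N elements is represented by an extension L of 'F_p of
   degree N. The sum of the conjugates y ^+ (p ^ i) lies in the prime subfield
   of L (abs_traceE), and the trace is the element of 'F_p it comes from. *)
Definition abs_trace (y : L) : 'F_p :=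
  odflt 0 [pick c : 'F_p | c%:A == \sum_(i < \dim {:L}) y ^+ (p ^ i)].

Lemma abs_traceE (y : L) : prime p ->
  (abs_trace y)%:A = \sum_(i < \dim {:L}) y ^+ (p ^ i).
Proof.
move=> p_pr; rewrite /abs_trace; case: pickP => [c /eqP //|nc] /=.
have cardF : #|'F_p| = p by rewrite card_Fp.
have chL : p \in [pchar L] by rewrite (rmorph_pchar (in_alg L)) // pchar_Fp.
have yN : y ^+ (p ^ \dim {:L}) = y.
  have := Fermat's_little_theorem {:L}%AS y.
  by rewrite memvf cardF => /esym/eqP.
have: \sum_(i < \dim {:L}) y ^+ (p ^ i) \in 1%VS.
  rewrite (Fermat's_little_theorem 1%AS) dimv1 expn1 cardF; apply/eqP.
  rewrite -(pFrobenius_autE chL) rmorph_sum /=.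
  under eq_bigr do rewrite pFrobenius_autE -exprM -expnSr.
  case: (\dim {:L}) yN (adim_gt0 {:L}%AS) => // N yN _.
  by rewrite big_ord_recr [RHS]big_ord_recl /= yN addrC expn0 expr1.
by case/vlineP => c Ec; have := nc c; rewrite Ec eqxx.
Qed.

(* exp(2 i pi Tr(y) / p) *)
Definition add_char (R : realType) (y : L) : R[i] :=
  let theta : R := 2 * pi * (val (abs_trace y))%:R / p%:R in
  Complex (cos theta) (sin theta).

(* finvect_type L is L itself, with its structure of finite type. *)
Definition exp_sum (R : realType) (g : {poly L}) : R[i] :=
  \sum_(x : finvect_type L) add_char R g.[x].

Definition trace_form (g : {poly L}) (x : L) : 'F_p := abs_trace g.[x].

End TraceAndExponentialSum.

Section QuadraticForm.
Variables (p : nat) (V : vectType 'F_p).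
Implicit Types (Q : V -> 'F_p) (r : nat) (d : 'F_p).

(* In the coordinates x_1, ..., x_N of some basis of V, the map Q is
   x_1^2 + ... + x_(r-1)^2 + d x_r^2, which is 0 when r = 0. *)
Definition diagonalizes Q r d : Prop :=
  [/\ (r <= \dim {:V})%N, d != 0 &
      exists2 b : (\dim {:V}).-tuple V, basis_of {:V} b &
        forall x, Q x =
          \sum_(i < \dim {:V} | (i.+1 < r)%N) coord b i x ^+ 2
          + \sum_(i < \dim {:V} | i.+1 == r) d * coord b i x ^+ 2].

Definition quad_rank Q : nat := xget 0%N [set r | exists d, diagonalizes Q r d].

Definition quad_nullity Q : nat := (\dim {:V} - quad_rank Q)%N.

Definition quad_char d : int :=
  if d == 0 then 0 else if [exists c : 'F_p, d == c ^+ 2] then 1 else -1.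

Definition quad_type Q : int :=
  if `[< forall x, Q x = 0 >] then 1
  else xget 1 [set t | exists r d, diagonalizes Q r d /\ t = quad_char d].

End QuadraticForm.

Definition nullity (p : nat) (L : fieldExtType 'F_p) (g : {poly L}) : nat :=
  quad_nullity (trace_form g).

Definition form_type (p : nat) (L : fieldExtType 'F_p) (g : {poly L}) : int :=
  quad_type (trace_form g).

(* Main.v *)
Require Import Defs.
From HB Require Import structures.
From mathcomp Require Import cyclic ring lra zify.

(* Let v be the p-adic order of n. Since p^(v+1) divides all the exponents
   alpha_i, an Artin-Schreier element t of the field with p^(p^(v+1)) elements,
   rescaled so that the Frobenius of L over K maps t to t + 1, is fixed by all
   the maps x |-> x^(p^alpha_i). The elements e_u = 1 - (t + u)^(p-1), u in F_p,
   are also fixed by these maps, and satisfy Tr_(L/K)(e_u e_w) = 1 if u = w, and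
   0 otherwise. Hence (x_u) |-> sum x_u e_u identifies the quadratic form of f on
   L with the orthogonal sum of p copies of its form on K, so that
   S(f, pn) = S(f, n)^p. Diagonalizing the forms expresses S through the rank,
   the type and the quadratic Gauss sum G, and everything follows from
   |G|^2 = p and conj(G) = eta(-1) G. *)

Set Implicit Arguments.
Unset Strict Implicit.
Unset Printing Implicit Defensive.

Import Order.TTheory GRing.Theory Num.Theory.
Local Open Scope ring_scope.

(** * The quadratic character of the prime field *)

Section FiniteField.
Variable F : finFieldType.

Lemma finField_prim_root : exists g : F, (#|F|.-1).-primitive_root g.
Proof.
have gt1 := finNzRing_gt1 F.
have n_gt0 : (0 < #|F|.-1)%N by rewrite -ltnS prednK // (ltn_trans _ gt1).
have rsP : all (#|F|.-1).-unity_root (enum (predC1 (0 : F))).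
  apply/allP => x; rewrite mem_enum inE /= => x_neq0.
  rewrite unity_rootE; apply/eqP/(mulfI x_neq0).
  by rewrite -exprS prednK ?expf_card ?mulr1 // (ltn_trans _ gt1).
have sz : (#|F|.-1 <= size (enum (predC1 (0%R : F))))%N by rewrite -cardE cardC1.
by have /hasP[g _ g_prim] := has_prim_root n_gt0 rsP (enum_uniq _) sz; exists g.
Qed.

Lemma natr_card_finField : #|F|%:R = 0 :> F.
Proof.
apply: (@addIr _ (\sum_(x : F) x)).
by rewrite add0r [RHS](reindex_inj (addrI 1)) /= big_split /= sumr_const.
Qed.

(** For 0 < j, multiplying by a generator g permutes [F] and scales the sum by g^j, which is not 1.
    For j = 0 the sum counts the elements. *)
Lemma sum_expr_finField j : (j < #|F|.-1)%N -> \sum_(x : F) x ^+ j = 0.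
Proof.
case: j => [|j] ltj.
  by under eq_bigr do rewrite expr0; rewrite sumr_const natr_card_finField.
have [g g_prim] := finField_prim_root.
have gj : g ^+ j.+1 != 1.
  rewrite -(prim_order_dvd g_prim); apply/negP => /(dvdn_leq (ltn0Sn j)).
  by rewrite leqNgt ltj.
have g_neq0 : g != 0.
  apply/eqP => g0; have := prim_expr_order g_prim; rewrite g0 expr0n.
  by rewrite gtn_eqF ?(leq_trans _ ltj) // => /eqP; rewrite eq_sym oner_eq0.
apply/eqP; have: (g ^+ j.+1 - 1) * (\sum_(x : F) x ^+ j.+1) == 0.
  rewrite mulrBl mul1r mulr_sumr [X in _ - X](reindex_inj (mulfI g_neq0)) subr_eq0 /=.
  by apply/eqP/eq_bigr => x _; rewrite exprMn.
by rewrite mulf_eq0 subr_eq0 (negPf gj).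
Qed.

Lemma sum_expr_pred_card_finField : \sum_(x : F) x ^+ #|F|.-1 = -1.
Proof.
have gt1 := finNzRing_gt1 F.
rewrite (bigD1 0) //= expr0n -subn1 subn_eq0 leqNgt gt1 add0r.
under eq_bigr => x x_neq0.
  have -> : x ^+ (#|F| - 1) = 1.
    apply: (mulfI x_neq0); rewrite subn1.
    by rewrite -exprS prednK ?expf_card ?mulr1 // (ltn_trans _ gt1).
  over.
rewrite sumr_const; apply/eqP; rewrite -addr_eq0 -mulrSr.
have -> : #|[pred i : F | i != 0]| = #|F|.-1 by rewrite -(cardC1 (0 : F)).
by rewrite prednK ?natr_card_finField // (ltn_trans _ gt1).
Qed.

End FiniteField.

Section QuadraticCharacter.
Variable p : nat.
Hypotheses (p_pr : prime p) (p_odd : odd p).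

Lemma Fp_2_neq0 : 2 != 0 :> 'F_p.
Proof.
rewrite -(dvdn_pcharf (pchar_Fp p_pr)); apply/negP => /(dvdn_leq (ltn0Sn 1)).
by have := prime_gt1 p_pr; move: p_odd; case: p => [|[|[]]].
Qed.

(** As p - 1 is even, the parity of an exponent of g is well defined, and the nonzero squares are
    the even powers. *)
Lemma quad_char_prim_root (g : 'F_p) j :
  (p.-1).-primitive_root g -> quad_char (g ^+ j) = (-1) ^+ j.
Proof.
move=> g_prim.
have p1_gt0 := prim_order_gt0 g_prim.
have g_neq0 : g != 0.
  apply/eqP => g0; have := prim_expr_order g_prim; rewrite g0 expr0n.
  by rewrite gtn_eqF // => /eqP; rewrite eq_sym oner_eq0.
rewrite /quad_char expf_eq0 (negPf g_neq0) andbF -signr_odd.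
have even_p1 : (2 %| p.-1)%N.
  by rewrite dvdn2; move: p_odd (prime_gt0 p_pr); case: p => //= m; rewrite negbK.
case: ifPn => [/existsP[c /eqP gc]|/existsPn nsq]; last first.
  case oj : (odd j); first by [].
  have /negP[] := nsq (g ^+ j./2).
  by rewrite -exprM muln2 -[X in g ^+ X]odd_double_half oj.
case oj : (odd j) => //.
have c_neq0 : c != 0.
  apply/eqP => c0; move: gc; rewrite c0 expr0n /= => /eqP.
  by rewrite expf_eq0 (negPf g_neq0) andbF.
have c1 : c ^+ p.-1 = 1.
  apply: (mulfI c_neq0); rewrite -exprS prednK ?prime_gt0 // mulr1.
  by rewrite -[X in c ^+ X](card_Fp p_pr) expf_card.
have [i ci] := prim_rootP g_prim c1.
move: gc; rewrite ci -exprM => /eqP; rewrite (eq_prim_root_expr g_prim).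
move=> /eqP ij; have := modn_dvdm j even_p1.
by rewrite ij (modn_dvdm _ even_p1) !modn2 oj muln2 odd_double.
Qed.

Lemma Fp_prim_root : exists g : 'F_p, (p.-1).-primitive_root g.
Proof. by have := finField_prim_root 'F_p; rewrite card_Fp. Qed.

Lemma Fp_neq0_expr (g x : 'F_p) :
  (p.-1).-primitive_root g -> x != 0 -> exists j, x = g ^+ j.
Proof.
move=> g_prim x_neq0; have x1 : x ^+ p.-1 = 1.
  apply: (mulfI x_neq0); rewrite -exprS prednK ?prime_gt0 // mulr1.
  by rewrite -[X in x ^+ X](card_Fp p_pr) expf_card.
by have [i ->] := prim_rootP g_prim x1; exists i.
Qed.

Lemma quad_char0 : quad_char (0 : 'F_p) = 0.
Proof. by rewrite /quad_char eqxx. Qed.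

Lemma quad_charM : {morph @quad_char p : x y / x * y}.
Proof.
move=> x y; have [g g_prim] := Fp_prim_root.
have [->|x_neq0] := eqVneq x 0; first by rewrite mul0r quad_char0 mul0r.
have [->|y_neq0] := eqVneq y 0; first by rewrite mulr0 quad_char0 mulr0.
have [i ->] := Fp_neq0_expr g_prim x_neq0.
have [j ->] := Fp_neq0_expr g_prim y_neq0.
by rewrite -exprD !quad_char_prim_root // exprD.
Qed.

(** A generator to the power (p-1)/2 is -1, so the left side is -1 to the product of the consecutive
    integers (p-1)/2 and (p+1)/2, which is even. *)
Lemma quad_charN1_expr : (@quad_char p (-1)) ^+ (p.+1)./2 = 1.
Proof.
have [g g_prim] := Fp_prim_root.
have p_gt2 : (2 < p)%N by rewrite odd_prime_gt2.
have p1E : p.-1 = (p./2).*2.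
  by rewrite -[in LHS](odd_double_half p) p_odd.
have half_gt0 : (0 < p./2)%N by rewrite half_gt0 ltnW.
have gN1 : -1 = g ^+ p./2.
  have : (g ^+ p./2) ^+ 2 == 1 ^+ 2.
    by rewrite -exprM muln2 -p1E (prim_expr_order g_prim) expr1n.
  rewrite eqf_sqr => /orP[|/eqP->//].
  rewrite -(prim_order_dvd g_prim) => /(dvdn_leq half_gt0).
  by rewrite p1E -addnn -{3}[p./2]addn0 leq_add2l leqNgt half_gt0.
rewrite gN1 quad_char_prim_root // -exprM -signr_odd oddM.
by rewrite [p.+1./2]uphalf_half p_odd add1n oddS andbN.
Qed.

Lemma quad_char_sqr (d : 'F_p) : d != 0 -> quad_char d ^+ 2 = 1.
Proof. by rewrite /quad_char => /negPf->; case: ifP. Qed.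

Lemma card_sqr_roots (y : 'F_p) :
  (#|[pred x : 'F_p | x ^+ 2 == y]|)%:Z = 1 + quad_char y.
Proof.
rewrite /quad_char; have [->|y_neq0] := eqVneq y 0.
  rewrite (@eq_card _ _ (pred1 0)) ?card1 ?addr0 // => x.
  by rewrite !inE sqrf_eq0.
case: ifPn => [/existsP[c /eqP yE]|/existsPn nsq]; last first.
  by rewrite eq_card0 ?subrr // => x; rewrite inE eq_sym (negPf (nsq x)).
have c_neq0 : c != 0 by move: y_neq0; rewrite yE sqrf_eq0.
rewrite (@eq_card _ _ (pred2 c (- c))) ?card2 => [|x].
  rewrite -addr_eq0 -mulr2n -mulr_natr mulf_eq0 (negPf c_neq0) (negPf Fp_2_neq0).
  by [].
by rewrite !inE yE eqf_sqr.
Qed.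

End QuadraticCharacter.

(** * Quadratic Gauss sums *)

Section AdditiveCharacter.
Variables (R : realType) (p : nat).
Hypotheses (p_pr : prime p) (p_odd : odd p).

(** The formula of [add_char] with the trace as argument: [exp_sum] is by conversion the sum of
    [Fp_char] over the values of [trace_form]. *)
Definition Fp_char (t : 'F_p) : R[i] :=
  let theta : R := 2 * pi * (val t)%:R / p%:R in
  Complex (cos theta) (sin theta).

Lemma expr_cos_sin (a : R) m :
  Complex (cos a) (sin a) ^+ m = Complex (cos (m%:R * a)) (sin (m%:R * a)).
Proof.
elim: m => [|m IHm]; first by rewrite mul0r cos0 sin0.
rewrite exprS IHm -natr1 mulrDl mul1r addrC cosD sinD; simpc.
by congr (_ +i* _)%C; rewrite addrC.
Qed.

Lemma Fp_char_expr m : Fp_char 1 ^+ m = Fp_char m%:R.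
Proof.
have p_neq0 : p%:R != 0 :> R by rewrite pnatr_eq0 -lt0n prime_gt0.
have per : Fp_char 1 ^+ p = 1.
  rewrite expr_cos_sin.
  have -> : p%:R * (2 * pi * (val (1 : 'F_p))%:R / p%:R) = 0 + pi *+ 2 :> R.
    rewrite (_ : val (1 : 'F_p) = 1%N) //=; field; exact: p_neq0.
  by rewrite cosD2pi sinD2pi cos0 sin0.
rewrite -(expr_mod _ per) expr_cos_sin /Fp_char /= val_Fp_nat //.
by rewrite (@modn_small 1) //; congr (Complex (cos _) (sin _)); field; exact: p_neq0.
Qed.

Lemma Fp_charD s t : Fp_char (s + t) = Fp_char s * Fp_char t.
Proof.
by rewrite -[s]natr_Zp -[t]natr_Zp -natrD -!Fp_char_expr exprD.
Qed.

Lemma Fp_char0 : Fp_char 0 = 1.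
Proof. by rewrite -(Fp_char_expr 0). Qed.

Lemma Fp_char_sum (I : Type) (r : seq I) (P : pred I) (F : I -> 'F_p) :
  Fp_char (\sum_(i <- r | P i) F i) = \prod_(i <- r | P i) Fp_char (F i).
Proof. exact: (big_morph _ Fp_charD Fp_char0). Qed.

Lemma conj_Fp_char t : Num.conj (Fp_char t) = Fp_char (- t).
Proof.
have ct : Num.conj (Fp_char t) * Fp_char t = 1.
  rewrite /Fp_char /Num.conj /=; simpc.
  by rewrite -!expr2 cos2Dsin2 [cos _ * sin _]mulrC subrr.
by rewrite -[LHS]mulr1 -Fp_char0 -(subrr t) Fp_charD mulrA ct mul1r.
Qed.

Lemma Fp_char1_neq1 : Fp_char 1 != 1.
Proof.
have p_gt0 : 0 < p%:R :> R by rewrite ltr0n prime_gt0.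
have p_gt2 : 2 < p%:R :> R by rewrite ltr_nat odd_prime_gt2.
(* The imaginary part is sin(2 pi / p), positive because p > 2. *)
apply/eqP => -[_ /eqP]; rewrite gt_eqF //; apply: sin_gt0_pi.
rewrite /= (@modn_small 1) //.
have pi0 := pi_gt0 R.
by rewrite mulr1 divr_gt0 ?mulr_gt0 //= ltr_pdivrMr // mulrC ltr_pM2l.
Qed.

Lemma sum_Fp_char : \sum_t Fp_char t = 0.
Proof.
apply/eqP; have: (Fp_char 1 - 1) * (\sum_t Fp_char t) == 0.
  rewrite mulrBl mul1r mulr_sumr [X in _ - X](reindex_inj (addrI 1)) subr_eq0.
  by apply/eqP/eq_bigr => t _; rewrite -Fp_charD.
by rewrite mulf_eq0 subr_eq0 (negPf Fp_char1_neq1).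
Qed.

Lemma sum_Fp_charM c : c != 0 -> \sum_t Fp_char (c * t) = 0.
Proof.
by move=> c_neq0; rewrite -[RHS]sum_Fp_char [RHS](reindex_inj (mulfI c_neq0)).
Qed.

Definition gauss_sum (c : 'F_p) : R[i] := \sum_x Fp_char (c * x ^+ 2).

Lemma gauss_sum0 : gauss_sum 0 = p%:R.
Proof.
rewrite /gauss_sum; under eq_bigr do rewrite mul0r Fp_char0.
by rewrite sumr_const card_Fp.
Qed.

(** Group the x by y = x^2: there are 1 + [quad_char y] of them, and the constant 1 contributes a
    vanishing character sum. *)
Lemma gauss_sum_quad_char c : c != 0 ->
  gauss_sum c = \sum_y (quad_char y)%:~R * Fp_char (c * y).
Proof.
move=> c_neq0; rewrite /gauss_sum (partition_big (fun x => x ^+ 2) predT) //=.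
rewrite -[RHS]add0r -[X in _ = X + _](sum_Fp_charM c_neq0) -big_split /=.
apply: eq_bigr => y _.
rewrite (eq_bigr (fun=> Fp_char (c * y))) => [|x /eqP-> //].
rewrite sumr_const -mulr_natl -[_%:R]/(_%:Z%:~R) card_sqr_roots //.
by rewrite rmorphD /= mulrDl mul1r.
Qed.

Lemma gauss_sumE c : c != 0 ->
  gauss_sum c = (quad_char c)%:~R * gauss_sum 1.
Proof.
move=> c_neq0; rewrite !gauss_sum_quad_char ?oner_eq0 //.
rewrite [in RHS](reindex_inj (mulfI c_neq0)) mulr_sumr.
apply: eq_bigr => y _; rewrite mul1r mulrA -rmorphM /= quad_charM //.
by rewrite mulrA -expr2 quad_char_sqr // mul1r.
Qed.

Lemma conj_gauss_sum1 :
  Num.conj (gauss_sum 1) = (@quad_char p (-1))%:~R * gauss_sum 1.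
Proof.
rewrite -gauss_sumE ?oppr_eq0 ?oner_eq0 // rmorph_sum.
by apply: eq_bigr => x _; rewrite [LHS]conj_Fp_char mul1r mulN1r.
Qed.

(** Writing the second variable as x + u makes the sum over x that of the character of 2ux, which
    vanishes unless u = 0. *)
Lemma norm_gauss_sum1 : `|gauss_sum 1| ^+ 2 = p%:R.
Proof.
rewrite normCKC rmorph_sum mulr_suml /=.
under eq_bigr => x _.
  rewrite mulr_sumr (reindex_inj (addrI x)) /=.
  under eq_bigr => u _.
    rewrite [X in X * _]conj_Fp_char -Fp_charD.
    rewrite (_ : _ + _ = u ^+ 2 + (2 * u) * x); last by ring.
    rewrite Fp_charD.
    over.
  over.
rewrite exchange_big /= (bigD1 0) //= [X in _ + X]big1 => [|u u_neq0].
  under eq_bigr do rewrite expr0n mulr0 mul0r Fp_char0 mul1r.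
  by rewrite sumr_const card_Fp // addr0.
by rewrite -mulr_sumr sum_Fp_charM ?mulr0 // mulf_neq0 ?Fp_2_neq0.
Qed.

Lemma gauss_sum1_neq0 : gauss_sum 1 != 0.
Proof.
apply/eqP => g0; have /eqP := norm_gauss_sum1.
by rewrite g0 normr0 expr0n eq_sym pnatr_eq0 eqn0Ngt prime_gt0.
Qed.

End AdditiveCharacter.

(** * Diagonalization of quadratic forms *)

Section Diagonalization.
Variable p : nat.
Hypotheses (p_pr : prime p) (p_odd : odd p).

Lemma quad_charP (d : 'F_p) : d != 0 ->
  (exists2 c, c != 0 & d = c ^+ 2) \/ quad_char d = -1.
Proof.
move=> d_neq0; rewrite /quad_char (negPf d_neq0).
case: ifP => [/existsP[c /eqP dE]|_]; [left|by right].
by exists c => //; move: d_neq0; rewrite dE sqrf_eq0.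
Qed.

Lemma quad_char_sqr1 (c : 'F_p) : c != 0 -> quad_char (c ^+ 2) = 1.
Proof. by move=> c_neq0; rewrite expr2 quad_charM // -expr2 quad_char_sqr. Qed.

(* If neither a nor b is a square, this amounts to 1/a being a sum of two
   squares: otherwise all sums of squares, hence all elements, would be squares. *)
Lemma Fp_binary_form_repr1 (a b : 'F_p) : a != 0 -> b != 0 ->
  exists x y, a * x ^+ 2 + b * y ^+ 2 = 1.
Proof.
move=> a_neq0 b_neq0.
have [[c c_neq0 aE]|a_nsq] := quad_charP a_neq0.
  by exists c^-1, 0; rewrite aE; field.
have [[c c_neq0 bE]|b_nsq] := quad_charP b_neq0.
  by exists 0, c^-1; rewrite bE; field.
have nsqM (s t : 'F_p) : s != 0 -> t != 0 -> quad_char s = -1 ->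
    quad_char t = -1 -> exists2 c, c != 0 & s * t = c ^+ 2.
  move=> s_neq0 t_neq0 s1 t1; have [//|] := quad_charP (mulf_neq0 s_neq0 t_neq0).
  by rewrite quad_charM // s1 t1.
have [e e_neq0 abE] := nsqM _ _ a_neq0 b_neq0 a_nsq b_nsq.
apply: contrapT => no_repr.
have sqD (x y : 'F_p) : exists z, x ^+ 2 + y ^+ 2 = z ^+ 2.
  have [s0|s_neq0] := eqVneq (x ^+ 2 + y ^+ 2) 0.
    by exists 0; rewrite s0 expr0n.
  have [[c _ ->]|s_nsq] := quad_charP s_neq0; first by exists c.
  have [t t_neq0 saE] := nsqM _ _ s_neq0 a_neq0 s_nsq a_nsq.
  (* With s = x^2 + y^2, ab = e^2 and sa = t^2, the form takes the value as / t^2 = 1 here. *)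
  case: no_repr; exists (x / t), (a * y / (e * t)).
  have -> : b * (a * y / (e * t)) ^+ 2 = a * b * (a * (y / t) ^+ 2) / e ^+ 2.
    by field; rewrite e_neq0 t_neq0.
  rewrite abE mulrAC divff ?sqrf_eq0 // mul1r -mulrDr !expr_div_n -mulrDl.
  by rewrite mulrA [a * _]mulrC saE divff // sqrf_eq0.
have sq_nat k : exists z : 'F_p, k%:R = z ^+ 2.
  elim: k => [|k [z kE]]; first by exists 0; rewrite expr0n.
  by have [y] := sqD z 1; rewrite expr1n -kE natr1; exists y.
have [z aE] := sq_nat (val a); rewrite natr_Zp in aE.
have z_neq0 : z != 0 by move: a_neq0; rewrite aE sqrf_eq0.
by move: a_nsq; rewrite aE quad_char_sqr1.
Qed.

(** The coefficients 1, ..., 1, d, 0, ..., 0 of the normal form, merging the two sums of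
    [diagonalizes] into one. *)
Definition diag_coef r (d : 'F_p) i : 'F_p :=
  if (i.+1 < r)%N then 1 else if i.+1 == r then d else 0.

Variable V : vectType 'F_p.

Lemma diagonalizes_coef (Q : V -> 'F_p) r d (b : (\dim {:V}).-tuple V) x :
  Q x = \sum_(i < \dim {:V} | (i.+1 < r)%N) coord b i x ^+ 2
        + \sum_(i < \dim {:V} | i.+1 == r) d * coord b i x ^+ 2 <->
  Q x = \sum_(i < \dim {:V}) diag_coef r d i * coord b i x ^+ 2.
Proof.
suff -> : \sum_(i < \dim {:V}) diag_coef r d i * coord b i x ^+ 2 =
   \sum_(i < \dim {:V} | (i.+1 < r)%N) coord b i x ^+ 2
        + \sum_(i < \dim {:V} | i.+1 == r) d * coord b i x ^+ 2 by [].
rewrite (big_mkcond (fun i => (_ < r)%N)) (big_mkcond (fun i => _ == r)) -big_split.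
apply: eq_bigr => i _ /=; rewrite /diag_coef.
case: (ltngtP i.+1 r) => _; rewrite ?mul1r ?mul0r ?addr0 ?add0r //.
Qed.

Variable B : V -> {linear V -> ('F_p)^o}.
Hypothesis B_sym : forall x y, B x y = B y x :> 'F_p.

(* Split off a vector of value 1 as long as there is one; when there is none,
   the form has rank at most 1, since binary forms represent 1. *)
Lemma orthogonal_basis (U : {vspace V}) :
  exists r d X, [/\ (r <= \dim U)%N, d != 0, basis_of U X &
    forall i j, (i < size X)%N -> (j < size X)%N ->
      B X`_i X`_j = (if i == j then diag_coef r d i else 0) :> 'F_p].
Proof.
have [m] := ubnP (\dim U); elim: m U => // m IHm U; rewrite ltnS => dimU.
have BZ x k y : B x (k *: y) = k * (B x y : 'F_p) :> 'F_p by rewrite linearZ.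
have Bpol x y : B (x + y) (x + y) = B x x + B y y + 2 * (B x y : 'F_p) :> 'F_p.
  rewrite linearD [B _ x]B_sym [B _ y]B_sym !linearD /= [B y x]B_sym.
  by ring.
(* If B v v is nonzero, U is the direct sum of the line of v and the orthogonal of v in U, to which
   induction applies. *)
have step v : v \in U -> B v v != 0 -> exists r d X,
   [/\ (r <= size X)%N /\ \dim U = (size X).+1, d != 0, basis_of U (v :: X),
       forall i, (i < size X)%N -> B v X`_i = 0 :> 'F_p &
    forall i j, (i < size X)%N -> (j < size X)%N ->
      B X`_i X`_j = (if i == j then diag_coef r d i else 0) :> 'F_p].
  move=> vU Bvv; have v_neq0 : v != 0 by apply: contraNneq Bvv => ->; rewrite linear0.
  pose U' := (U :&: lker (linfun (B v)))%VS.
  have U'P x : x \in U' -> x \in U /\ B v x = 0.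
    by rewrite memv_cap memv_ker lfunE => /andP[-> /eqP->].
  have UE : U = (<[v]> + U')%VS.
    apply/vspaceP => x; apply/idP/idP => [xU|/memv_addP[y /vlineP[k ->]]]; last first.
      by case=> z /U'P[zU _] ->; rewrite rpredD // rpredZ.
    rewrite -[x](subrK ((B v x / B v v : 'F_p) *: v)) addrC.
    rewrite memv_add ?memvZ ?memv_line //.
    rewrite memv_cap rpredB ?rpredZ // memv_ker lfunE /= linearB /= BZ.
    by rewrite divfK // subrr.
  have dUU' : directv (<[v]> + U').
    apply/directv_addP/vspaceP => x; rewrite memv0 memv_cap.
    apply/andP/eqP => [[/vlineP[k ->]] /U'P[_]|->]; last by rewrite !mem0v.
    rewrite BZ => /eqP; rewrite mulf_eq0 (negPf Bvv) orbF.
    by move/eqP->; rewrite scale0r.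
  have dimU' : \dim U = (\dim U').+1.
    by rewrite [in LHS]UE (directvP dUU') /= dim_vline v_neq0.
  have [|r [d [X [ler d_neq0 bX BX]]]] := IHm U'; first by rewrite -dimU'.
  have sizeX : \dim U' = size X := size_basis (X := in_tuple X) bX.
  exists r, d, X; split=> //.
  - by rewrite dimU' -sizeX.
  - by rewrite UE; apply: (cat_basis dUU' (seq1_basis v_neq0) bX).
  by move=> i ltiX; have [] // := U'P (X`_i) (basis_mem bX (mem_nth _ ltiX)).
have [[v [vU Bv1]]|no1] := pselect (exists v, v \in U /\ B v v = 1 :> 'F_p).
  have [|r [d [X [[ler dimUX] d_neq0 bX BvX BX]]]] := step v vU.
    by rewrite Bv1 oner_eq0.
  (* The vector v goes in front. If r = 0, its coefficient 1 becomes the last nonzero one, so the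
     new d must be 1. *)
  exists r.+1, (if r is 0%N then 1 else d), (v :: X); split=> //.
    by rewrite dimUX.
    by case: (r) => [|_] //; rewrite oner_eq0.
  case=> [|i] [|j] //= lti ltj; last 2 first.
  - by rewrite B_sym BvX.
  - by rewrite BX // /diag_coef ltnS eqSS; case: (r).
  - by rewrite Bv1 /diag_coef ltnS eqSS; case: (r).
  by rewrite BvX.
have [[v [vU Bv]]|B0] := pselect (exists v, v \in U /\ B v v <> 0 :> 'F_p); last first.
  have BU0 x : x \in U -> B x x = 0 :> 'F_p.
    by move=> xU; apply: contrapT => Bx; apply: B0; exists x.
  exists 0%N, 1, (vbasis U); split; rewrite ?oner_eq0 ?vbasisP // => i j lti ltj.
  have iU := vbasis_mem (mem_nth 0 lti); have jU := vbasis_mem (mem_nth 0 ltj).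
  (* By polarization, B vanishes on U because all its values B x x do and 2 is invertible. *)
  have /eqP := Bpol (vbasis U)`_i (vbasis U)`_j.
  rewrite !BU0 ?rpredD // !add0r eq_sym mulf_eq0 (negPf (Fp_2_neq0 p_pr p_odd)).
  by move/eqP->; rewrite if_same.
have {}Bv : B v v != 0 :> 'F_p by apply/eqP.
have [r [d [X [[ler dimUX] d_neq0 bX BvX BX]]]] := step v vU Bv.
have r0 : r = 0%N.
  case: (posnP r) => // r_gt0; case: no1.
  have X_gt0 := leq_trans r_gt0 ler.
  have BX0 : B X`_0 X`_0 != 0 :> 'F_p.
    by rewrite BX // /diag_coef; case: (r) r_gt0 => [|[]] // _; rewrite oner_eq0.
  have XU : X`_0 \in U by rewrite (basis_mem bX) // inE mem_nth ?orbT.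
  have [x [y xyE]] := Fp_binary_form_repr1 Bv BX0.
  exists (x *: v + y *: X`_0); rewrite rpredD ?rpredZ //; split=> //.
  rewrite Bpol !BZ B_sym BZ [B (y *: _) _]B_sym !BZ [B (x *: _) _]B_sym BZ.
  by rewrite [B X`_0 v]B_sym BvX // -[RHS]xyE; ring.
exists 1%N, (B v v), (v :: X); split=> //; first by rewrite dimUX.
case=> [|i] [|j] //= lti ltj; rewrite ?BvX //.
  by rewrite B_sym BvX.
by rewrite BX // r0 /diag_coef if_same.
Qed.

Lemma bilinear_diagonalizes : exists r d, diagonalizes (fun x => B x x : 'F_p) r d.
Proof.
have [r [d [X [ler d_neq0 bX BX]]]] := orthogonal_basis {:V}.
have sizeX : size X == \dim {:V} by rewrite -(size_basis (X := in_tuple X) bX).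
exists r, d; split=> //; exists (Tuple sizeX) => // x; apply/diagonalizes_coef.
have xE := coord_basis (X := Tuple sizeX) bX (memvf x).
rewrite {1 2}xE linear_sum; apply: eq_bigr => i _ /=.
rewrite linearZ B_sym linear_sum (bigD1 i) //= big1 => [|j ij].
  rewrite linearZ /= BX ?(eqP sizeX) // eqxx addr0 /GRing.scale /=; ring.
rewrite linearZ /= BX ?(eqP sizeX) //.
by rewrite [i == j :> nat]eq_sym [_ == _](negPf ij) scaler0.
Qed.

End Diagonalization.

(** * Character sums of diagonal forms *)

Section QuadraticGaussSum.
Variables (R : realType) (p : nat).
Hypotheses (p_pr : prime p) (p_odd : odd p).
Variable V : vectType 'F_p.
Local Notation N := (\dim {:V}).
Implicit Types (Q : V -> 'F_p).

Lemma card_finvect : #|finvect_type V| = (p ^ N)%N.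
Proof.
by rewrite -(card_vspacef (Vector.class (finvect_type V))) card_vspace card_Fp.
Qed.

(** Each coefficient 0 gives p, each coefficient 1 gives G, and d gives [quad_char d] times G; for r
    = 0 there is no coefficient d. *)
Lemma prod_gauss_sum_diag_coef r (d : 'F_p) : (r <= N)%N -> d != 0 ->
  \prod_(i < N) gauss_sum R (diag_coef r d i) =
  p%:R ^+ (N - r) * (if r is 0%N then 1 else (quad_char d)%:~R)
  * gauss_sum R (1 : 'F_p) ^+ r.
Proof.
move=> ler d_neq0; rewrite -(big_mkord xpredT (fun i => gauss_sum R (diag_coef r d i))).
rewrite (big_cat_nat (n := r)) //= [X in _ * X](eq_big_nat _ _ (F2 := fun=> p%:R)).
  rewrite prodr_const_nat mulrC -mulrA; congr (_ * _).
  case: r ler => [|r] _; first by rewrite big_geq // mulr1.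
  rewrite big_nat_recr //= {2}/diag_coef ltnn eqxx gauss_sumE //.
  rewrite (eq_big_nat _ _ (F2 := fun=> gauss_sum R (1 : 'F_p))) => [|i /andP[_ ltir]].
    by rewrite prodr_const_nat subn0 mulrCA exprSr.
  by rewrite /diag_coef ltnS ltir.
move=> i /andP[leri _]; rewrite /diag_coef ltnNge leqW //= gtn_eqF ?ltnS //.
by rewrite gauss_sum0.
Qed.

(** In diagonalizing coordinates the sum over V factors into one-variable Gauss sums. *)
Lemma sum_Fp_char_diagonalizes Q r d : diagonalizes Q r d ->
  \sum_(x : finvect_type V) Fp_char R (Q x) =
  p%:R ^+ (N - r) * (if r is 0%N then 1 else (quad_char d)%:~R)
  * gauss_sum R (1 : 'F_p) ^+ r.
Proof.
case=> ler d_neq0 [b b_basis QE]; rewrite -prod_gauss_sum_diag_coef //.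
rewrite bigA_distr_bigA /=.
pose g (h : {ffun 'I_N -> 'F_p}) : finvect_type V := \sum_i h i *: b`_i.
have coord_g h i : coord b i (g h) = h i.
  by rewrite coord_sum_free ?(basis_free b_basis).
have g_bij : bijective g.
  apply: inj_card_bij => [h h' gE|]; first by apply/ffunP => i; rewrite -!coord_g gE.
  by rewrite card_ffun card_Fp // card_ord card_finvect.
rewrite (reindex g) /=; last exact: onW_bij.
apply: eq_bigr => h _; have /diagonalizes_coef -> := QE (g h).
by rewrite Fp_char_sum //; apply: eq_bigr => i _; rewrite coord_g.
Qed.

End QuadraticGaussSum.

(** * Rank and type recovered from the character sum *)

Section QuadraticInvariants.
Variables (R : realType) (p : nat).
Hypotheses (p_pr : prime p) (p_odd : odd p).
Local Notation S Q := (\sum_(x : finvect_type _) Fp_char R (Q x)).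

Section OneForm.
Variables (V : vectType 'F_p) (Q : V -> 'F_p).
Local Notation N := (\dim {:V}).

(** The sign has modulus 1 and |G|^2 = p, whence the exponent 2(N - r) + r. The modulus thus
    determines the rank. *)
Lemma norm_sum_Fp_char r d : diagonalizes Q r d ->
  `|S Q| ^+ 2 = p%:R ^+ (N + (N - r)).
Proof.
move=> Qrd; have [ler d_neq0 _] := Qrd.
rewrite (sum_Fp_char_diagonalizes _ p_pr p_odd Qrd) !normrM !exprMn !normrX normr_nat.
have -> : `|if r is 0%N then 1 else (quad_char d)%:~R| ^+ 2 = 1 :> R[i].
  case: (r) => [|_]; first by rewrite normr1 expr1n.
  by rewrite /quad_char (negPf d_neq0); case: ifP; rewrite ?normrN1 ?normr1 expr1n.
rewrite mulr1 [X in _ * X]exprAC norm_gauss_sum1 // -exprM -exprD; congr (_ ^+ _).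
by lia.
Qed.

Lemma diagonalizes_rank_inj r d r' d' :
  diagonalizes Q r d -> diagonalizes Q r' d' -> r = r'.
Proof.
move=> Qrd Qrd'; have [ler _ _] := Qrd; have [ler' _ _] := Qrd'.
have /eqP := norm_sum_Fp_char Qrd; rewrite (norm_sum_Fp_char Qrd').
rewrite -!natrX eqr_nat eqn_exp2l ?prime_gt1 // => /eqP; lia.
Qed.

Lemma quad_rankE r d : diagonalizes Q r d -> quad_rank Q = r.
Proof.
move=> Qrd; rewrite /quad_rank; case: xgetP => [s -> [d'] Qsd'|/(_ r)].
  exact: diagonalizes_rank_inj Qsd' Qrd.
by case; exists d.
Qed.

Lemma quad_typeE r d : diagonalizes Q r d ->
  quad_type Q = if r is 0%N then 1 else quad_char d.
Proof.
move=> Qrd; rewrite /quad_type; case: asboolP => [Q0|Qn0].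
  suff -> : r = 0%N by [].
  apply: (diagonalizes_rank_inj (d' := 1) Qrd); split; rewrite ?oner_eq0 //.
  exists (vbasis {:V}); first exact: vbasisP.
  by move=> x; apply/diagonalizes_coef; rewrite Q0 big1 // => i _; rewrite mul0r.
case: r Qrd => [|r] Qrd.
  have [_ _ [b _ QE]] := Qrd; case: Qn0 => x.
  by have /diagonalizes_coef -> := QE x; rewrite big1 // => i _; rewrite mul0r.
case: xgetP => [t -> [r' [d' [Qrd' ->]]]|/(_ (quad_char d))]; last first.
  by case; exists r.+1, d.
have r'E := diagonalizes_rank_inj Qrd' Qrd; rewrite {r'}r'E in Qrd'.
(* The ranks agree, so the powers of p and of G cancel and the two signs are equal. *)
have := sum_Fp_char_diagonalizes R p_pr p_odd Qrd.
rewrite (sum_Fp_char_diagonalizes R p_pr p_odd Qrd').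
move/(mulIf (expf_neq0 _ (gauss_sum1_neq0 R p_pr p_odd))).
have p_neq0 : p%:R != 0 :> R[i] by rewrite pnatr_eq0 -lt0n prime_gt0.
by move/(mulfI (expf_neq0 _ p_neq0))/intr_inj.
Qed.

Lemma conj_sum_Fp_char r d : diagonalizes Q r d ->
  Num.conj (S Q) = (@quad_char p (-1))%:~R ^+ r * S Q.
Proof.
move=> Qrd; rewrite (sum_Fp_char_diagonalizes R p_pr p_odd Qrd).
rewrite !rmorphM !rmorphXn /= conj_gauss_sum1 // rmorph_nat exprMn.
rewrite mulrCA; congr (_ * (_ * _)); congr (_ * _).
by case: (r) => [|_]; rewrite ?rmorph1 ?rmorph_int.
Qed.

(* S^p = |S|^(p-1) conj(S) because conj(S) = e^r S for a sign e such that
   e^((p+1)/2) = 1. *)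
Lemma exprp_sum_Fp_char r d : diagonalizes Q r d ->
  S Q ^+ p = real_complex R (p%:R `^ (2^-1 * (p%:R - 3) * (N + (N - r))%:R))
             * `|S Q| ^+ 2 * Num.conj (S Q).
Proof.
move=> Qrd; have p_gt2 : (2 < p)%N by rewrite odd_prime_gt2.
(* Here k = (p-3)/2, so the real power of p becomes a natural one, and (p+1)/2 = k + 2. *)
have [k pE] : exists k, p = (k.*2 + 3)%N by exists (p - 3)./2; lia.
have -> : 2^-1 * (p%:R - 3) * (N + (N - r))%:R = (k * (N + (N - r)))%:R :> R.
  by rewrite natrM [X in X%:R - 3]pE -muln2 natrD natrM; field.
rewrite powR_mulrn ?ler0n // rmorphXn rmorph_nat mulnC exprM.
(* The right side is now S^(k+1) conj(S)^(k+2), and conj(S) is S up to a power of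
   [quad_char (-1)]. *)
rewrite -(norm_sum_Fp_char Qrd) -exprSr normCK exprMn -mulrA -exprSr.
rewrite (conj_sum_Fp_char Qrd) exprMn mulrCA exprAC.
have -> : (@quad_char p (-1))%:~R ^+ k.+2 = 1 :> R[i].
  have := quad_charN1_expr p_pr p_odd; have -> : p.+1./2 = k.+2 by lia.
  move=> e.
  by rewrite -rmorphXn e.
by rewrite expr1n mul1r -exprD; congr (_ ^+ _); lia.
Qed.

End OneForm.

Variables (V W : vectType 'F_p) (QV : V -> 'F_p) (QW : W -> 'F_p).

Lemma quad_invariants_exprp r d r' d' :
    diagonalizes QV r d -> diagonalizes QW r' d' ->
    \dim {:W} = (p * \dim {:V})%N -> S QW = S QV ^+ p ->
  quad_nullity QW = (p * quad_nullity QV)%N /\ quad_type QW = quad_type QV.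
Proof.
move=> Vrd Wrd dimW SE; have [ler d_neq0 _] := Vrd; have [ler' _ _] := Wrd.
have p_neq0 : p%:R != 0 :> R[i] by rewrite pnatr_eq0 -lt0n prime_gt0.
(* Comparing moduli gives 2pN - r' = p(2N - r). *)
have r'E : r' = (p * r)%N.
  have := norm_sum_Fp_char Wrd; rewrite SE normrX exprAC (norm_sum_Fp_char Vrd).
  move/eqP; rewrite -exprM -!natrX eqr_nat eqn_exp2l ?prime_gt1 // dimW.
  by move: ler'; rewrite dimW => ? /eqP; nia.
rewrite /quad_nullity (quad_rankE Vrd) (quad_rankE Wrd) (quad_typeE Vrd).
rewrite (quad_typeE Wrd) r'E dimW mulnBr; split=> //.
have := sum_Fp_char_diagonalizes R p_pr p_odd Wrd; rewrite SE.
rewrite (sum_Fp_char_diagonalizes R p_pr p_odd Vrd) !exprMn -!exprM r'E dimW.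
rewrite -mulnBr [(r * p)%N]mulnC [((_ - _) * p)%N]mulnC.
move/(mulIf (expf_neq0 _ (gauss_sum1_neq0 R p_pr p_odd))).
move/(mulfI (expf_neq0 _ p_neq0)).
(* For r = 0 both types are 1. Otherwise the remaining signs satisfy [quad_char d'] = [quad_char d]
   to the power p, and p is odd. *)
case: (r) => [|r0]; first by rewrite muln0.
case: (p * r0.+1)%N (muln_gt0 p r0.+1) => [|m _]; first by rewrite (prime_gt0 p_pr).
rewrite -rmorphXn => /intr_inj <-; have pE := odd_double_half p.
by rewrite -[X in _ ^+ X = _]pE p_odd exprS -mul2n exprM quad_char_sqr // expr1n mulr1.
Qed.

End QuadraticInvariants.

(** * Artin-Schreier elements and self-dual bases *)

Section FrobeniusPowers.
Variables (p : nat) (L : fieldExtType 'F_p).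
Hypothesis p_pr : prime p.
Implicit Types (x y : L) (i m : nat).

Lemma pchar_Fp_ext : p \in [pchar L].
Proof. by rewrite (rmorph_pchar (in_alg L)) // pchar_Fp. Qed.

Lemma exprpn_nat (A : nzRingType) i : p \in [pchar A] -> [pchar A].-nat (p ^ i)%N.
Proof. by move=> pA; rewrite pnatX pnatE // pA. Qed.

Lemma exprpnD i x y : (x + y) ^+ (p ^ i) = x ^+ (p ^ i) + y ^+ (p ^ i).
Proof. by rewrite exprDn_pchar // exprpn_nat // pchar_Fp_ext. Qed.

Lemma exprpn_sum i (I : Type) (r : seq I) (P : pred I) (F : I -> L) :
  (\sum_(j <- r | P j) F j) ^+ (p ^ i) = \sum_(j <- r | P j) F j ^+ (p ^ i).
Proof.
apply: (big_morph _ (exprpnD i)).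
by rewrite expr0n expn_eq0 eqn0Ngt prime_gt0.
Qed.

Lemma exprpnN i x : (- x) ^+ (p ^ i) = - x ^+ (p ^ i).
Proof.
apply/eqP; rewrite -addr_eq0 -exprpnD addNr.
by rewrite expr0n expn_eq0 eqn0Ngt prime_gt0.
Qed.

Lemma natr_exprpn i m : m%:R ^+ (p ^ i) = m%:R :> L.
Proof.
elim: m => [|m IHm]; first by rewrite expr0n expn_eq0 eqn0Ngt prime_gt0.
by rewrite -natr1 exprpnD expr1n IHm.
Qed.

Lemma Fp_scalar_natr (c : 'F_p) : c%:A = (val c)%:R :> L.
Proof. by rewrite -{1}[c]natr_Zp scaler_nat. Qed.

Lemma natr_Fp_scalar m : m%:R = (m%:R : 'F_p)%:A :> L.
Proof. by rewrite scaler_nat. Qed.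

Lemma exprpn_dim x : x ^+ (p ^ \dim {:L}) = x.
Proof.
have := Fermat's_little_theorem {:L}%AS x.
by rewrite memvf card_Fp // => /esym/eqP.
Qed.

Lemma exprpn_fix_mul i m x : x ^+ (p ^ i) = x -> x ^+ (p ^ (i * m)) = x.
Proof.
move=> xE; elim: m => [|m IHm]; first by rewrite muln0 expr1.
by rewrite mulnS expnD exprM xE.
Qed.

Lemma exprpnZ i (c : 'F_p) x : (c *: x) ^+ (p ^ i) = c *: x ^+ (p ^ i).
Proof.
by rewrite -(mulr_algl c x) exprMn Fp_scalar_natr natr_exprpn -Fp_scalar_natr mulr_algl.
Qed.

Lemma abs_trace_linear (c : 'F_p) x y :
  abs_trace (c *: x + y) = c * abs_trace x + abs_trace y.
Proof.
apply: (fmorph_inj (in_alg L)); rewrite rmorphD rmorphM /= !abs_traceE //.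
rewrite mulr_algl scaler_sumr -big_split; apply: eq_bigr => i _ /=.
by rewrite exprpnD exprpnZ.
Qed.

Lemma abs_trace_sum (I : Type) (r : seq I) (P : pred I) (F : I -> L) :
  abs_trace (\sum_(j <- r | P j) F j) = \sum_(j <- r | P j) abs_trace (F j).
Proof.
apply: big_morph => [x y|].
  by have := abs_trace_linear 1 x y; rewrite scale1r mul1r.
by have := abs_trace_linear (-1) 0 0; rewrite scaler0 addr0 mulN1r addNr.
Qed.

End FrobeniusPowers.

Section ArtinSchreier.
Variables (p : nat) (L : fieldExtType 'F_p).
Hypothesis p_pr : prime p.

(* X^q - X - 1 divides X^(q^j) - X - j for all j, and X^(#|L|) - X, which
   splits over L, is one of these with p | j. *)
Lemma Artin_Schreier_root v : (p ^ v.+1 %| \dim {:L})%N ->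
  exists t : L, t ^+ (p ^ (p ^ v)) = t + 1.
Proof.
case/dvdnP => c dimL; pose q := (p ^ (p ^ v))%N.
have q_gt1 : (1 < q)%N.
  by rewrite -[1%N](exp1n (p ^ v)) ltn_exp2r ?prime_gt1 ?expn_gt0 ?prime_gt0.
pose A : {poly L} := 'X^q - ('X + 1%:P).
have sizeA : size A = q.+1.
  rewrite /A size_polyDl size_polyXn // size_polyN size_XaddC; lia.
have pA : p \in [pchar {poly L}].
  by rewrite (rmorph_pchar (@polyC L)) // pchar_Fp_ext.
have qD (a b : {poly L}) : (a - b) ^+ q = a ^+ q - b ^+ q.
  rewrite exprDn_pchar ?exprpn_nat //; congr (_ + _); apply/eqP.
  rewrite -addr_eq0 -exprDn_pchar ?exprpn_nat // addNr expr0n.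
  by rewrite gtn_eqF // ltnW.
have dvdA j : A %| 'X^(q ^ j) - ('X + (j%:R)%:P).
  elim: j => [|j IHj]; first by rewrite expr1 addr0 subrr dvdp0.
  (* The q-th power of X^(q^j) - X - j is X^(q^(j+1)) - X^q - j, and adding A replaces X^q by X +
     1. *)
  have -> : 'X^(q ^ j.+1) - ('X + j.+1%:R%:P) =
     ('X^(q ^ j) - ('X + (j%:R)%:P)) ^+ q + A :> {poly L}.
    rewrite qD [('X + _) ^+ q]exprDn_pchar ?exprpn_nat //.
    rewrite -polyC_exp natr_exprpn // -exprM -expnSr -natr1 polyCD /A; ring.
  rewrite dvdp_add ?dvdpp // (dvdp_trans IHj) // -[X in X %| _]expr1.
  by rewrite dvdp_exp2l // ltnW.
have : A %| \prod_(x : finvect_type L) ('X - x%:P).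
  have cardL : #|finvect_type L| = (q ^ (p * c))%N.
    by rewrite card_finvect // dimL -expnM; congr (_ ^ _)%N; rewrite expnSr; lia.
  have := dvdA (p * c)%N.
  rewrite natrM pcharf0 ?pchar_Fp_ext // mul0r addr0 -cardL.
  by rewrite (finField_genPoly (finvect_type L)).
(* Up to a unit, A is the product of X - x over a sublist, nonempty because A has positive
   degree. *)
case/dvdp_prod_XsubC => m; case: (mask _ _) => [|x s].
  rewrite big_nil => /eqp_size; rewrite sizeA size_poly1 => -[q0].
  by rewrite q0 in q_gt1.
move=> eqA; have: root A x by rewrite (eqp_root eqA) root_prod_XsubC mem_head.
rewrite /root /A !hornerE subr_eq0 => /eqP tE.
by exists x.
Qed.

Lemma exprpn_translate m (t : L) j : t ^+ (p ^ m) = t + 1 ->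
  t ^+ (p ^ (m * j)) = t + j%:R.
Proof.
move=> tE; elim: j => [|j IHj]; first by rewrite muln0 expr1 addr0.
by rewrite mulnS expnD exprM tE exprpnD // IHj expr1n -natr1 addrA.
Qed.

(** Let n = p^v k with k prime to p. The p^n-th power shifts an Artin-Schreier root by k, so the
    root divided by k is shifted by 1. If p^(v+1) divides m, the shift is a multiple of p, hence
    0. *)
Lemma Artin_Schreier_generator n : (0 < n)%N -> \dim {:L} = (p * n)%N ->
  exists2 t : L, t ^+ (p ^ n) = t + 1 &
    forall m, (p ^ (logn p n).+1 %| m)%N -> t ^+ (p ^ m) = t.
Proof.
move=> n_gt0 dimL; set v := logn p n.
have [|t tE] := @Artin_Schreier_root v.
  by rewrite dimL expnS dvdn_pmul2l ?prime_gt0 // pfactor_dvdnn.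
have nE : n = (p ^ v * (n %/ p ^ v))%N by rewrite mulnC divnK // pfactor_dvdnn.
set k := (n %/ p ^ v)%N in nE.
have k_neq0 : k%:R != 0 :> L.
  rewrite -(dvdn_pcharf (pchar_Fp_ext L p_pr)); apply/negP => /dvdnP[c kE].
  have : (p ^ v.+1 %| n)%N by rewrite nE kE expnSr mulnCA dvdn_mull.
  by rewrite pfactor_dvdn // ltnn.
have scaleE m : (t / k%:R) ^+ (p ^ (p ^ v * m)) = (t + m%:R) / k%:R.
  by rewrite expr_div_n natr_exprpn // exprpn_translate.
exists (t / k%:R) => [|m /dvdnP[c ->]].
  by rewrite nE scaleE mulrDl divff.
rewrite expnSr mulnC -mulnA scaleE natrM pcharf0 ?pchar_Fp_ext //.
by rewrite mul0r addr0.
Qed.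

End ArtinSchreier.

Section SelfDualBasis.
Variables (p : nat) (L : fieldExtType 'F_p) (t : L).
Hypotheses (p_pr : prime p) (p_odd : odd p).

(** Every power of u in the binomial expansion has exponent below p - 1, so it sums to 0. *)
Lemma sum_exprD_Fp (s : L) j : (j < p.-1)%N ->
  \sum_(u : 'F_p) (s + u%:A) ^+ j = 0.
Proof.
move=> ltj; under eq_bigr do rewrite exprDn.
rewrite exchange_big big1 //= => i _; rewrite sumrMnl -mulr_sumr.
under eq_bigr do rewrite exprZn expr1n.
rewrite -scaler_suml sum_expr_finField ?scale0r ?mulr0 ?mul0rn //.
by rewrite card_Fp // (leq_ltn_trans _ ltj) // -ltnS.
Qed.

Lemma sum_exprD_pred_Fp (s : L) :
  \sum_(u : 'F_p) (s + u%:A) ^+ p.-1 = -1.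
Proof.
under eq_bigr do rewrite exprDn big_ord_recr /= subnn mul1r binn.
rewrite big_split /= [X in X + _]exchange_big [X in X + _]big1 /= ?add0r => [|i _].
  under eq_bigr do rewrite exprZn expr1n.
  have := sum_expr_pred_card_finField 'F_p; rewrite card_Fp // => sE.
  by rewrite -scaler_suml sE scaleN1r.
rewrite sumrMnl -mulr_sumr.
under eq_bigr do rewrite exprZn expr1n.
by rewrite -scaler_suml sum_expr_finField ?card_Fp // scale0r mulr0 mul0rn.
Qed.

(* The value at t of the Lagrange polynomial of -u on the points of F_p. The
   orthogonality relations come from the fact that (t + u) * dual_elt u does not
   depend on u. *)
Definition dual_elt (u : 'F_p) : L := 1 - (t + u%:A) ^+ p.-1.

Lemma mul_dual_elt u : (t + u%:A) * dual_elt u = t - t ^+ p.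
Proof.
rewrite /dual_elt mulrBr mulr1 -exprS prednK ?prime_gt0 //.
rewrite -[X in _ ^+ X](expn1 p) exprpnD // Fp_scalar_natr natr_exprpn // expn1.
by rewrite opprD addrACA subrr addr0.
Qed.

Lemma sum_dual_elt i : \sum_u dual_elt (i + u) = 1.
Proof.
transitivity (\sum_u dual_elt u); first by rewrite [RHS](reindex_inj (addrI i)).
rewrite big_split /= sumr_const.
by rewrite card_Fp // pcharf0 ?pchar_Fp_ext // sumrN sum_exprD_pred_Fp add0r opprK.
Qed.

Lemma dual_eltM i j : \sum_u dual_elt (i + u) * dual_elt (j + u) = (i == j)%:R.
Proof.
have [<-{j}|ij] := eqVneq i j; last first.
  (* The factor i - j is the difference of t + i + u and t + j + u, each of which turns its own dual
     element into t - t^p. *)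
  apply/eqP; have: (i - j)%:A * (\sum_u dual_elt (i + u) * dual_elt (j + u)) == 0.
    rewrite mulr_sumr; under eq_bigr => u _.
      have -> : (i - j)%:A * (dual_elt (i + u) * dual_elt (j + u)) =
         (t - t ^+ p) * dual_elt (j + u) - (t - t ^+ p) * dual_elt (i + u).
        rewrite -{1}(mul_dual_elt (i + u)) -(mul_dual_elt (j + u)).
        rewrite !scalerDl scaleNr; ring.
      over.
    by rewrite sumrB -!mulr_sumr !sum_dual_elt subrr.
  by rewrite mulf_eq0 scaler_eq0 subr_eq0 (negPf ij) oner_eq0.
transitivity (\sum_u dual_elt u * dual_elt u).
  by rewrite [RHS](reindex_inj (addrI i)).
(* With s = t + u, one factor is 1 - s s^(p-2), and s times the other is t - t^p; the powers s^(p-2)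
   sum to 0. *)
under eq_bigr => u _.
  have -> : dual_elt u * dual_elt u =
      dual_elt u - (t - t ^+ p) * (t + u%:A) ^+ p.-2.
    rewrite -(mul_dual_elt u); set s := t + u%:A.
    have eE : dual_elt u = 1 - s * s ^+ p.-2.
      by rewrite -exprS /dual_elt; congr (_ - _ ^+ _); have := prime_gt1 p_pr; lia.
    by rewrite [X in _ * X = _]eE; ring.
  over.
rewrite sumrB -mulr_sumr sum_exprD_Fp ?mulr0 ?subr0; last first.
  by have := odd_prime_gt2 p_odd p_pr; lia.
by rewrite -[RHS](sum_dual_elt 0); apply: eq_bigr => u _; rewrite add0r.
Qed.

End SelfDualBasis.

(** * Descent of the trace form *)

Section TraceForm.
Variables (p : nat) (L : fieldExtType 'F_p).
Hypotheses (p_pr : prime p) (p_odd : odd p).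
Variables (k : nat) (a : 'I_k -> L) (alpha : 'I_k -> nat).

(** Frobenius powers are F_p-linear, so each monomial is the diagonal of a bilinear map; half the
    symmetrized trace is a symmetric bilinear form with [trace_form] as its diagonal. *)
Lemma trace_form_diagonalizes :
  exists r d, diagonalizes (trace_form (\sum_i a i *: 'X^(p ^ alpha i + 1))) r d.
Proof.
pose M x y := \sum_i a i * (x ^+ (p ^ alpha i) * y).
have M_linl (c : 'F_p) x y z : M (c *: x + y) z = c *: M x z + M y z.
  rewrite scaler_sumr -big_split; apply: eq_bigr => i _ /=.
  by rewrite exprpnD // exprpnZ // mulrDl mulrDr -scalerAl -scalerAr.
have M_linr (c : 'F_p) x y z : M z (c *: x + y) = c *: M z x + M z y.
  rewrite scaler_sumr -big_split; apply: eq_bigr => i _ /=.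
  by rewrite !mulrDr -!scalerAr.
pose B x y : ('F_p)^o := 2^-1 * (abs_trace (M x y) + abs_trace (M y x)).
have B_lin x : linear (B x).
  move=> c y z; rewrite /B M_linl M_linr !abs_trace_linear //.
  rewrite /GRing.scale /=; ring.
pose Bl x : {linear L -> ('F_p)^o} :=
  HB.pack (B x) (GRing.isLinear.Build 'F_p L ('F_p)^o _ (B x) (B_lin x)).
have B_sym x y : Bl x y = Bl y x by rewrite /= /B addrC.
have [r [d Brd]] := bilinear_diagonalizes p_pr p_odd B_sym.
exists r, d; congr (diagonalizes _ r d): Brd; apply/funext => x /=.
rewrite /B /trace_form horner_sum -mulr2n.
rewrite -(mulr_natl (abs_trace _)) mulKf ?Fp_2_neq0 //.
congr abs_trace; apply: eq_bigr => i _.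
by rewrite hornerZ hornerXn addn1 exprSr.
Qed.

End TraceForm.

Lemma sum_natr_Fp (p : nat) (A : nmodType) (F : 'F_p -> A) : prime p ->
  \sum_(u < p) F u%:R = \sum_u F u.
Proof.
move=> p_pr; rewrite [RHS](reindex (fun u : 'I_p => u%:R)) //=.
apply/onW_bij/inj_card_bij; last by rewrite card_Fp // card_ord.
move=> u w /(congr1 val); rewrite /= !val_Fp_nat // !modn_small //.
exact: val_inj.
Qed.

(** * The trace from L down to K *)

Section RelativeTrace.
Variables (p n : nat) (K L : fieldExtType 'F_p) (iota : {rmorphism K -> L}).
Hypothesis p_pr : prime p.
Hypotheses (dimK : \dim {:K} = n) (dimL : \dim {:L} = (p * n)%N).

(** The trace of L over the image of K as a sum of conjugates, with values kept in L. *)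
Definition rel_trace (y : L) : L := \sum_(u < p) y ^+ (p ^ (n * u)).

Lemma rel_trace_sum (I : Type) (r : seq I) (P : pred I) (F : I -> L) :
  rel_trace (\sum_(j <- r | P j) F j) = \sum_(j <- r | P j) rel_trace (F j).
Proof.
rewrite /rel_trace exchange_big; apply: eq_bigr => u _ /=.
exact: exprpn_sum.
Qed.

Lemma rel_traceZ x y : rel_trace (iota x * y) = iota x * rel_trace y.
Proof.
rewrite /rel_trace mulr_sumr; apply: eq_bigr => u _.
by rewrite exprMn -[iota x ^+ _]rmorphXn exprpn_fix_mul // -dimK exprpn_dim.
Qed.

(** Transitivity of the trace: the exponents below pn are the un + i with u < p and i < n. *)
Lemma abs_trace_rel_trace x y : rel_trace y = iota x -> abs_trace y = abs_trace x.
Proof.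
move=> yx; apply: (fmorph_inj (in_alg L)); rewrite /= !abs_traceE //.
have -> : (abs_trace x)%:A = iota (abs_trace x)%:A :> L.
  by rewrite !Fp_scalar_natr rmorph_nat.
rewrite abs_traceE // rmorph_sum dimL dimK.
rewrite -(big_mkord xpredT (fun i => y ^+ (p ^ i))) big_nat_mul big_mkord.
under eq_bigr => u _ do rewrite -[(u * n)%N]add0n big_addn mulSn addnK big_mkord.
rewrite exchange_big; apply: eq_bigr => i _ /=.
rewrite rmorphXn /= -yx exprpn_sum //; apply: eq_bigr => u _.
by rewrite -exprM -expnD; congr (_ ^+ (_ ^ _)); lia.
Qed.

End RelativeTrace.

(** * Splitting the form on L into p copies of the form on K *)

Section DescentToFrobeniusFixedField.
Variables (p n : nat) (K L : fieldExtType 'F_p) (iota : {rmorphism K -> L}).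
Hypotheses (p_pr : prime p) (p_odd : odd p).
Hypotheses (dimK : \dim {:K} = n) (dimL : \dim {:L} = (p * n)%N).
Variable t : L.
Hypothesis tE : t ^+ (p ^ n) = t + 1.

(** The u-th iterate of the p^n-th power sends [dual_elt t w] to [dual_elt t (w + u)], so the
    relative trace is the sum in [dual_eltM]. *)
Lemma rel_trace_dual_eltM i j :
  rel_trace n (dual_elt t i * dual_elt t j) = (i == j)%:R.
Proof.
rewrite -(dual_eltM t p_pr p_odd) -sum_natr_Fp //; apply: eq_bigr => u _.
have frobE w : dual_elt t w ^+ (p ^ (n * u)) = dual_elt t (w + u%:R).
  rewrite /dual_elt exprpnD // exprpnN // expr1n exprAC exprpnD //.
  rewrite exprpn_translate // [w%:A]Fp_scalar_natr natr_exprpn //.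
  by rewrite -Fp_scalar_natr -addrA natr_Fp_scalar -scalerDl [_ + w]addrC.
by rewrite exprMn !frobE.
Qed.

Definition dual_comb (h : 'F_p -> K) : L :=
  \sum_u iota (h u) * dual_elt t u.

Lemma rel_trace_dual_comb h j :
  rel_trace n (dual_comb h * dual_elt t j) = iota (h j).
Proof.
rewrite mulr_suml rel_trace_sum // (bigD1 j) //= big1 => [|u uj].
  by rewrite -mulrA rel_traceZ // rel_trace_dual_eltM eqxx mulr1 addr0.
by rewrite -mulrA rel_traceZ // rel_trace_dual_eltM (negPf uj) mulr0.
Qed.

(** Relative traces against the dual elements recover the coefficients, and both sides have p^(pn)
    elements. *)
Lemma dual_comb_bij :
  bijective (fun h : {ffun 'F_p -> finvect_type K} => dual_comb h : finvect_type L).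
Proof.
apply: inj_card_bij => [h h' hE|]; last first.
  by rewrite card_ffun !card_finvect // card_Fp // dimK dimL -expnM mulnC.
apply/ffunP => j; apply: (fmorph_inj iota).
by rewrite -!rel_trace_dual_comb [dual_comb h]hE.
Qed.

Variables (k : nat) (a : 'I_k -> K) (alpha : 'I_k -> nat).
Hypothesis t_fix : forall i, t ^+ (p ^ alpha i) = t.
Let f := \sum_i a i *: 'X^(p ^ alpha i + 1).

(** The Frobenius powers in f fix the dual elements and act on the coefficients alone;
    orthonormality for the relative trace then kills all cross terms. *)
Lemma trace_form_dual_comb h :
  trace_form (map_poly iota f) (dual_comb h) = \sum_u trace_form f (h u).
Proof.
have -> : \sum_u trace_form f (h u) = abs_trace (\sum_u f.[h u]).
  by rewrite abs_trace_sum.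
apply: (abs_trace_rel_trace (iota := iota) p_pr dimK dimL).
have fix_dual i u : dual_elt t u ^+ (p ^ alpha i) = dual_elt t u.
  rewrite /dual_elt exprpnD // exprpnN // expr1n exprAC exprpnD // t_fix.
  by rewrite Fp_scalar_natr natr_exprpn.
have fE (y : L) : (map_poly iota f).[y] = \sum_i iota (a i) * (y ^+ (p ^ alpha i) * y).
  rewrite rmorph_sum horner_sum; apply: eq_bigr => i _.
  by rewrite /= map_polyZ map_polyXn hornerZ hornerXn addn1 exprSr.
rewrite fE rel_trace_sum // rmorph_sum.
under [RHS]eq_bigr do rewrite horner_sum rmorph_sum.
rewrite [RHS]exchange_big; apply: eq_bigr => i _ /=.
rewrite rel_traceZ //.
have -> : dual_comb h ^+ (p ^ alpha i) =
    \sum_u iota (h u ^+ (p ^ alpha i)) * dual_elt t u.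
  by rewrite exprpn_sum //; apply: eq_bigr => u _; rewrite exprMn fix_dual rmorphXn.
rewrite mulr_suml rel_trace_sum // mulr_sumr; apply: eq_bigr => u _.
rewrite [_ * dual_comb h]mulr_sumr rel_trace_sum // (bigD1 u) //= big1 => [|w wu].
  rewrite mulrACA -rmorphM rel_traceZ // rel_trace_dual_eltM eqxx mulr1 addr0.
  by rewrite -rmorphM hornerZ hornerXn addn1 exprSr.
rewrite mulrACA -rmorphM rel_traceZ // rel_trace_dual_eltM eq_sym (negPf wu).
by rewrite mulr0.
Qed.

Lemma exp_sum_lift (R : realType) :
  exp_sum R (map_poly iota f) = exp_sum R f ^+ p.
Proof.
rewrite -[X in _ ^+ X](card_Fp p_pr) -prodr_const.
rewrite (bigA_distr_bigA (fun (_ : 'F_p) (x : finvect_type K) => add_char R f.[x])) /=.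
rewrite /exp_sum.
rewrite (reindex (fun h : {ffun 'F_p -> finvect_type K} =>
                   dual_comb h : finvect_type L)) /=; last exact/onW_bij/dual_comb_bij.
apply: eq_bigr => h _; rewrite -(Fp_char_sum R p_pr).
by rewrite -trace_form_dual_comb.
Qed.

End DescentToFrobeniusFixedField.

(** * From the condition on p-adic orders to the formulas for the sum, the nullity and the type *)

Lemma lt_padic_order_dvdn p n m : prime p -> (0 < n)%N ->
  (padic_order p n < padic_order p m)%E -> (p ^ (logn p n).+1 %| m)%N.
Proof.
move=> p_pr n_gt0; rewrite /padic_order gtn_eqF //.
case: posnP => [->|m_gt0]; first by rewrite dvdn0.
by rewrite lte_fin ltz_nat pfactor_dvdn.
Qed.

Theorem theorem6p2 (R : realType) (p n : nat) (p_pr : prime p) (p_odd : odd p)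
    (n_gt0 : (0 < n)%N)
    (K L : fieldExtType 'F_p) (dimK : \dim {:K} = n) (dimL : \dim {:L} = (p * n)%N)
    (iota : {rmorphism K -> L})
    (k : nat) (a : 'I_k.+1 -> K) (alpha : 'I_k.+1 -> nat)
    (alpha_incr : {homo alpha : i j / (i < j)%N})
    (a_last : a ord_max != 0)
    (f : {poly K})
    (fE : f = \sum_(i < k.+1) a i *: 'X^(p ^ alpha i + 1))
    (nu_lt : (padic_order p n <
              \big[Order.min/+oo]_(i < k.+1) padic_order p (alpha i))%E) :
  let fL : {poly L} := map_poly iota f in
  [/\ exp_sum R fL =
        real_complex R (p%:R `^ (2^-1 * (p%:R - 3) * (n + nullity f)%:R))
        * `|exp_sum R f| ^+ 2 * Num.conj (exp_sum R f),
      nullity fL = (p * nullity f)%N &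
      form_type fL = form_type f].
Proof.
move=> fL.
have alpha_dvd i : (p ^ (logn p n).+1 %| alpha i)%N.
  apply: lt_padic_order_dvdn => //; apply: (lt_le_trans nu_lt).
  exact: bigmin_le.
have [t tE t_fix] := Artin_Schreier_generator p_pr n_gt0 dimL.
have SE : exp_sum R fL = exp_sum R f ^+ p.
  rewrite /fL fE; apply: (exp_sum_lift iota p_pr p_odd dimK dimL tE) => i.
  exact: t_fix.
have [r [d Krd]] := trace_form_diagonalizes p_pr p_odd a alpha.
have [r' [d' Lrd]] := trace_form_diagonalizes p_pr p_odd (iota \o a) alpha.
rewrite -fE in Krd.
have fLE : \sum_i (iota \o a) i *: 'X^(p ^ alpha i + 1) = fL.
  rewrite /fL fE rmorph_sum; apply: eq_bigr => i _.
  by rewrite /= map_polyZ map_polyXn.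
rewrite fLE in Lrd.
have dimLK : \dim {:L} = (p * \dim {:K})%N by rewrite dimK.
have [nullE typeE] := quad_invariants_exprp p_pr p_odd Krd Lrd dimLK SE.
split=> //; rewrite SE [LHS](exprp_sum_Fp_char R p_pr p_odd Krd).
by rewrite /nullity /quad_nullity (quad_rankE R p_pr p_odd Krd) dimK.
Qed.
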